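(* Fix any $\mathbf{u}\in\mathcal{U}^m_a$, with $\mathbf{c}_u$, $\mathbf{a}$, $V_c$, $P_u$, $\mathcal{Z}_a$, $\mathcal{S}^+_a$, $P^d_u$, $\mathbf{G}$, $\boldsymbol\tau_u$ as in the context. If $\bar{\boldsymbol\zeta}\in\mathcal{S}^+_a$ is a solution of the canonical dual problem $(\mathcal{P}^d):\ \max\{P^d_u(\boldsymbol\zeta):\boldsymbol\zeta\in\mathcal{S}^+_a\}$, then $$\bar{\boldsymbol\rho}=\tfrac12\,\mathbf{G}(\bar{\boldsymbol\zeta})^{-1}\boldsymbol\tau_u(\bar{\boldsymbol\zeta})$$ is a global optimal solution of $(\mathcal{P}):\ \min\{P_u(\boldsymbol\rho):\boldsymbol\rho\in\mathcal{Z}_a\}$, and $$P_u(\bar{\boldsymbol\rho})=\min_{\boldsymbol\rho\in\mathcal{Z}_a}P_u(\boldsymbol\rho)=\max_{\boldsymbol\zeta\in\mathcal{S}^+_a}P^d_u(\boldsymbol\zeta)=P^d_u(\bar{\boldsymbol\zeta}).$$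
   Context: Setting (finite element topology optimization): a design domain is divided into $n$ finite elements $\Omega_e$; $\mathbf{a}=(a_1,\dots,a_n)$ with $a_e=\mathrm{Vol}(\Omega_e)>0$; $V_c>0$ is the desired volume; $\mathcal{U}^m_a\subset\mathbb{R}^m$ is the admissible nodal displacement space. For a given $\mathbf{u}\in\mathcal{U}^m_a$, $\mathbf{c}_u=\mathbf{c}(\mathbf{u})\in\mathbb{R}^n$ is the vector of element energies $c_e(\mathbf{u})=\int_{\Omega_e}W(\nabla\mathbf{N}(\mathbf{x})\mathbf{u}_e)\,d\Omega$ (with $W$ the stored energy density, $\mathbf{N}$ the interpolation matrix, $\mathbf{u}_e$ the element nodal displacements); these are nonnegative. $P_u(\boldsymbol\rho)=-\mathbf{c}_u^T\boldsymbol\rho$ and $\mathcal{Z}_a=\{\boldsymbol\rho\in\{0,1\}^n:\boldsymbol\rho^T\mathbf{a}\le V_c\}$ (so $(\mathcal{P})$ is a 0-1 knapsack problem). For $\boldsymbol\zeta=(\boldsymbol\sigma,\varsigma)\in\mathbb{R}^n\times\mathbb{R}$ let $\mathbf{G}(\boldsymbol\zeta)=\mathrm{Diag}(\boldsymbol\sigma)$ and $\boldsymbol\tau_u(\boldsymbol\zeta)=\boldsymbol\sigma-\varsigma\mathbf{a}+\mathbf{c}_u$. Let $\mathcal{S}^+_a=\{(\boldsymbol\sigma,\varsigma):\boldsymbol\sigma>0\ (\text{componentwise}),\ \varsigma\ge0\}$ and, on $\mathcal{S}^+_a$, $P^d_u(\boldsymbol\zeta)=-\frac14\boldsymbol\tau_u(\boldsymbol\zeta)^T\mathbf{G}(\boldsymbol\zeta)^{-1}\boldsymbol\tau_u(\boldsymbol\zeta)-\varsigma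 V_c$. A solution of $(\mathcal{P}^d)$ means a maximizer of $P^d_u$ attained in $\mathcal{S}^+_a$. *)

(* Defs.v *)
From HB Require Import structures.
From mathcomp Require Import all_boot all_order all_algebra.
From mathcomp Require Import all_classical all_reals all_analysis.

Set Implicit Arguments.
Unset Strict Implicit.
Unset Printing Implicit Defensive.

Import Order.TTheory GRing.Theory Num.Theory.
Import numFieldNormedType.Exports.

Local Open Scope classical_set_scope.
Local Open Scope ring_scope.

(* R^d with its Borel sigma-algebra. *)
Notation borel_rV R d := (g_sigma_algebraType (@open 'rV[R]_d)).

(* The value on boxes characterizes d-dimensional Lebesgue measure among the
   Borel measures on R^d. *)
Definition is_lebesgue (R : realType) (d : nat)
    (mu : {measure set (borel_rV R d) -> \bar R}) : Prop :=
  forall a b : 'rV[R]_d, (forall j, a 0 j <= b 0 j) ->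
    mu [set x : 'rV[R]_d | forall j, a 0 j <= x 0 j <= b 0 j]
    = (\prod_(j < d) (b 0 j - a 0 j))%:E.

(* u_e: [dof] sends the local degrees of freedom of an element to the global
   ones. *)
Definition restrict_dof (R : realType) (m k : nat) (dof : 'I_k -> 'I_m)
    (u : 'cV[R]_m) : 'cV[R]_k :=
  \col_i u (dof i) 0.

(* (grad N(x)) u_e, with entries \sum_l (d N_il / d x_j)(x) (u_e)_l. *)
Definition grad_interp (R : realType) (d k : nat) (N : 'rV[R]_d -> 'M[R]_(d, k))
    (ue : 'cV[R]_k) (x : 'rV[R]_d) : 'M[R]_d :=
  \matrix_(i, j)
    \sum_(l < k) 'D_('e_j) (fun y : 'rV[R]_d => N y i l : R^o) x * ue l 0.

Definition elt_energy (R : realType) (d k : nat)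
    (mu : {measure set (borel_rV R d) -> \bar R}) (E : set (borel_rV R d))
    (W : 'M[R]_d -> R) (N : 'rV[R]_d -> 'M[R]_(d, k)) (ue : 'cV[R]_k) : R :=
  \int[mu]_(x in E) W (grad_interp N ue x).

(* A design domain of R^d divided into n finite elements, with m global nodal
   degrees of freedom. Distinct elements may share boundary points, so they are
   only required to overlap in volume zero. *)
Record fe_model (R : realType) (d m n : nat) := FEModel {
  fe_vol : {measure set (borel_rV R d) -> \bar R} ;
  fe_vol_lebesgue : is_lebesgue fe_vol ;
  fe_domain : set (borel_rV R d) ;
  fe_elt : 'I_n -> set (borel_rV R d) ;
  fe_elt_measurable : forall e, measurable (fe_elt e) ;
  fe_elt_cover : \bigcup_e fe_elt e = fe_domain ;
  fe_elt_overlap : forall e f, e != f -> fe_vol (fe_elt e `&` fe_elt f) = 0%E ;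
  fe_elt_vol_gt0 : forall e, (0 < fe_vol (fe_elt e))%E ;
  fe_elt_vol_fin : forall e, (fe_vol (fe_elt e) < +oo)%E ;
  fe_ndof : 'I_n -> nat ;
  fe_dof : forall e, 'I_(fe_ndof e) -> 'I_m ;
  fe_interp : forall e, 'rV[R]_d -> 'M[R]_(d, fe_ndof e) ;
  fe_interp_diff : forall e i l, {ae fe_vol, forall x : borel_rV R d,
    fe_elt e x ->
    differentiable (fun y : 'rV[R]_d => fe_interp e y i l : R^o)
      (x : 'rV[R]_d)} ;
  fe_W : 'M[R]_d -> R ;
  fe_adm : set 'cV[R]_m ;
  fe_W_integrable : forall u, fe_adm u -> forall e,
    fe_vol.-integrable (fe_elt e) (fun x : borel_rV R d =>
      (fe_W (grad_interp (@fe_interp e) (restrict_dof (@fe_dof e) u) x))%:E) ;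
  fe_energy_ge0 : forall u, fe_adm u -> forall e,
    0 <= elt_energy fe_vol (fe_elt e) fe_W (@fe_interp e)
           (restrict_dof (@fe_dof e) u)
}.

Section topology_optimization.
Variables (R : realType) (d m n : nat) (M : fe_model R d m n).

Definition vol_vec : 'cV[R]_n := \col_e fine (fe_vol M (fe_elt M e)).

Definition energy_vec (u : 'cV[R]_m) : 'cV[R]_n :=
  \col_e elt_energy (fe_vol M) (fe_elt M e) (fe_W M) (@fe_interp _ _ _ _ M e)
           (restrict_dof (@fe_dof _ _ _ _ M e) u).

Definition Pu (u : 'cV[R]_m) (rho : 'cV[R]_n) : R :=
  - ((energy_vec u)^T *m rho) 0 0.

Definition Za (Vc : R) : set 'cV[R]_n :=
  [set rho : 'cV[R]_n | (forall e, rho e 0 = 0 \/ rho e 0 = 1)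
             /\ (rho^T *m vol_vec) 0 0 <= Vc].

Definition Gmx (zeta : 'cV[R]_n * R) : 'M[R]_n := diag_mx zeta.1^T.

Definition tau (u : 'cV[R]_m) (zeta : 'cV[R]_n * R) : 'cV[R]_n :=
  zeta.1 - zeta.2 *: vol_vec + energy_vec u.

Definition Sa_plus : set ('cV[R]_n * R) :=
  [set zeta : 'cV[R]_n * R | (forall e, 0 < zeta.1 e 0) /\ 0 <= zeta.2].

Definition Pdu (Vc : R) (u : 'cV[R]_m) (zeta : 'cV[R]_n * R) : R :=
  - (1 / 4) * ((tau u zeta)^T *m invmx (Gmx zeta) *m tau u zeta) 0 0
  - zeta.2 * Vc.

End topology_optimization.

Definition global_minimizer (R : realType) (T : Type) (A : set T) (f : T -> R)
    (x : T) : Prop :=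
  A x /\ forall y, A y -> f x <= f y.

Definition global_maximizer (R : realType) (T : Type) (A : set T) (f : T -> R)
    (x : T) : Prop :=
  A x /\ forall y, A y -> f y <= f x.

(* v = min_A f, the minimum being attained. *)
Definition is_min (R : realType) (T : Type) (A : set T) (f : T -> R) (v : R) :
    Prop :=
  (f @` A) v /\ lbound (f @` A) v.

(* v = max_A f, the maximum being attained. *)
Definition is_max (R : realType) (T : Type) (A : set T) (f : T -> R) (v : R) :
    Prop :=
  (f @` A) v /\ ubound (f @` A) v.

(* Main.v *)
Require Import Defs.
From mathcomp Require Import all_boot all_order all_algebra.
From mathcomp Require Import all_classical all_reals all_analysis.
From mathcomp Require Import ring lra.

(** Put rho_e = tau_e / (2 sigma_e).  For fixed varsigma the dual is separable
    in sigma, and a maximum over sigma_e > 0 forces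
    sigma_e^2 = (c_e - varsigma a_e)^2, which says exactly that rho_e is 0 or 1.
    Its derivative in varsigma is rho^T a - V_c, so optimality over
    varsigma >= 0 gives feasibility of rho and complementary slackness.
    These yield P_u(rho) = P^d_u(zeta), and completing the square gives weak
    duality P^d_u <= P_u on S_a^+ x Z_a, hence optimality of rho. *)

Set Implicit Arguments.
Unset Strict Implicit.
Unset Printing Implicit Defensive.

Import Order.TTheory GRing.Theory Num.Theory.
Local Open Scope classical_set_scope.
Local Open Scope ring_scope.

Lemma invmx_diag_mx (F : fieldType) (n : nat) (v : 'rV[F]_n) :
  (forall i, v 0 i != 0) -> invmx (diag_mx v) = diag_mx (\row_i (v 0 i)^-1).
Proof.
move=> v_neq0; set w := \row_i _.
have vw1 : diag_mx v *m diag_mx w = 1%:M.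
  apply/matrixP => i j; rewrite mul_diag_mx !mxE.
  by case: eqP => [->|_]; rewrite ?mulr0n ?mulr0 // mulr1n mulfV.
have [v_unit _] := mulmx1_unit vw1.
by rewrite -[RHS](mulKmx v_unit) vw1 mulmx1.
Qed.

(** * Duality for the 0-1 knapsack problem in scalar coordinates *)

Section KnapsackDual.
Variables (R : realFieldType) (I : finType) (c a : I -> R) (V : R).
Implicit Types (sigma rho : I -> R) (s : R).

Definition knapsack_dual sigma s : R :=
  - (1 / 4) * (\sum_i (sigma i - s * a i + c i) ^+ 2 / sigma i) - s * V.

(** With [t] the numerator and [sigma i] positive, this is the minimizer over real [r] of
    [sigma i * r ^+ 2 - t * r]. *)
Definition dual_point sigma s (i : I) : R :=
  (sigma i - s * a i + c i) / (2 * sigma i).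

Lemma knapsack_weak_duality sigma s rho :
  (forall i, 0 < sigma i) -> 0 <= s ->
  (forall i, rho i = 0 \/ rho i = 1) -> \sum_i rho i * a i <= V ->
  knapsack_dual sigma s <= - \sum_i c i * rho i.
Proof.
move=> sigma_gt0 s_ge0 rho01 rhoV.
have term i : c i * rho i <=
    1 / 4 * ((sigma i - s * a i + c i) ^+ 2 / sigma i) + s * (rho i * a i).
  set t := sigma i - s * a i + c i.
  have sq_ge0 : 0 <= sigma i * (rho i - t / (2 * sigma i)) ^+ 2.
    by rewrite mulr_ge0 ?sqr_ge0 // ltW.
  have rho_sq : rho i ^+ 2 = rho i by case: (rho01 i) => ->; rewrite ?expr0n ?expr1n.
  have sq_expand : sigma i * (rho i - t / (2 * sigma i)) ^+ 2 =
      sigma i * rho i ^+ 2 - t * rho i + 1 / 4 * (t ^+ 2 / sigma i).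
    by field; rewrite gt_eqF.
  have -> : c i * rho i = t * rho i - sigma i * rho i + s * (rho i * a i).
    by rewrite /t; ring.
  by rewrite sq_expand rho_sq in sq_ge0; lra.
have : \sum_i c i * rho i <=
    1 / 4 * (\sum_i (sigma i - s * a i + c i) ^+ 2 / sigma i)
    + s * \sum_i rho i * a i.
  by rewrite !mulr_sumr -big_split /=; apply: ler_sum => i _.
have := ler_wpM2l s_ge0 rhoV; rewrite /knapsack_dual; lra.
Qed.

(** The dual is quadratic in [s], so its second-order expansion is exact and optimality in [s] can
    be tested without derivatives. *)
Lemma knapsack_dualD sigma s h : (forall i, 0 < sigma i) ->
  knapsack_dual sigma (s + h) = knapsack_dual sigma s
    + h * (\sum_i dual_point sigma s i * a i - V)
    - h ^+ 2 * \sum_i a i ^+ 2 / (4 * sigma i).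
Proof.
move=> sigma_gt0; rewrite /knapsack_dual /dual_point.
have sumE : - (1 / 4) * (\sum_i (sigma i - (s + h) * a i + c i) ^+ 2 / sigma i) =
    - (1 / 4) * (\sum_i (sigma i - s * a i + c i) ^+ 2 / sigma i)
    + h * (\sum_i (sigma i - s * a i + c i) / (2 * sigma i) * a i)
    - h ^+ 2 * \sum_i a i ^+ 2 / (4 * sigma i).
  rewrite !mulr_sumr -sumrN -!big_split /=; apply: eq_bigr => i _.
  by field; rewrite gt_eqF.
by rewrite sumE; ring.
Qed.

(** For small [h] a positive linear term would outgrow the quadratic one. The cap [s0] allows for
    steps that must keep [s] nonnegative. *)
Lemma first_order_le0 (D K s0 : R) : 0 < s0 -> 0 <= K ->
  (forall h, 0 < h -> h <= s0 -> h * D <= h ^+ 2 * K) -> D <= 0.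
Proof.
move=> s0_gt0 K_ge0 DK; rewrite leNgt; apply/negP => D_gt0.
have K1_gt0 : 0 < K + 1 by lra.
(* This choice gives [h * K < D]; adding 1 keeps the divisor positive when [K] is 0. *)
pose h := Num.min s0 (D / (K + 1)).
have h_gt0 : 0 < h by rewrite lt_min s0_gt0 divr_gt0.
have h_le : h * (K + 1) <= D by rewrite -ler_pdivlMr // ge_min lexx orbT.
have := DK h h_gt0; rewrite ge_min lexx /= => /(_ isT).
by rewrite expr2 -mulrA ler_pM2l //; lra.
Qed.

(** * Optimality conditions at a dual maximizer *)

Section Maximizer.
Variables (sigma : I -> R) (s : R).
Hypotheses (sigma_gt0 : forall i, 0 < sigma i) (s_ge0 : 0 <= s).
Hypothesis dual_max : forall sigma' s', (forall i, 0 < sigma' i) -> 0 <= s' ->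
  knapsack_dual sigma' s' <= knapsack_dual sigma s.

Local Notation rho := (dual_point sigma s).

Lemma dual_curvature_ge0 : 0 <= \sum_i a i ^+ 2 / (4 * sigma i).
Proof.
by apply: sumr_ge0 => i _; rewrite divr_ge0 ?sqr_ge0 // mulr_ge0 // ltW.
Qed.

Lemma dual_point_feasible : \sum_i rho i * a i <= V.
Proof.
(* Increasing [s] is always admissible, so the cap 1 is arbitrary. *)
rewrite -subr_le0; apply: (first_order_le0 ltr01 dual_curvature_ge0) => h h_gt0 _.
have := dual_max sigma_gt0 (addr_ge0 s_ge0 (ltW h_gt0)).
by rewrite knapsack_dualD //; lra.
Qed.

(** If [s] is positive it can also be decreased, by at most [s], which gives the inequality opposite
    to feasibility. *)
Lemma dual_point_slackness : s * (\sum_i rho i * a i - V) = 0.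
Proof.
have [->|s_neq0] := eqVneq s 0; first by rewrite mul0r.
have s_gt0 : 0 < s by rewrite lt_def s_neq0.
suff DN : - (\sum_i rho i * a i - V) <= 0.
  have := dual_point_feasible => D.
  have -> : \sum_i rho i * a i - V = 0 by lra.
  by rewrite mulr0.
apply: (first_order_le0 s_gt0 dual_curvature_ge0) => h h_gt0 h_le.
have sh_ge0 : 0 <= s + - h by lra.
have := dual_max sigma_gt0 sh_ge0.
by rewrite knapsack_dualD // sqrrN; lra.
Qed.

(** Changing a single coordinate of [sigma] leaves the other summands fixed, so maximality passes to
    each summand. *)
Lemma dual_max_coord i t : 0 < t ->
  (sigma i - s * a i + c i) ^+ 2 / sigma i <= (t - s * a i + c i) ^+ 2 / t.
Proof.
move=> t_gt0; pose sigma' j := if j == i then t else sigma j.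
have sigma'_gt0 j : 0 < sigma' j by rewrite /sigma'; case: eqP.
have := dual_max sigma'_gt0 s_ge0.
rewrite /knapsack_dual (bigD1 i) //= [in X in _ <= X](bigD1 i) //=.
rewrite (eq_bigr (fun j => (sigma j - s * a j + c j) ^+ 2 / sigma j)); last first.
  by move=> j /negPf ji; rewrite /sigma' ji.
by rewrite {1 2}/sigma' eqxx; lra.
Qed.

(** Up to a constant the summand is [t + b ^+ 2 / t], which for nonzero [b] is minimal over positive
    [t] only at the absolute value of [b]. *)
Lemma dual_max_sqr i : sigma i ^+ 2 = (c i - s * a i) ^+ 2.
Proof.
set b := c i - s * a i.
have s_gt0 := sigma_gt0 i.
have expand t : 0 < t -> (t - s * a i + c i) ^+ 2 / t = t + 2 * b + b ^+ 2 / t.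
  by move=> t_gt0; rewrite /b; field; rewrite gt_eqF.
have coord t : 0 < t -> sigma i + b ^+ 2 / sigma i <= t + b ^+ 2 / t.
  by move=> t_gt0; have := dual_max_coord i t_gt0; rewrite !expand //; lra.
have [b0|b_neq0] := eqVneq b 0.
  (* For [b = 0] the function reduces to [t], which has no minimum over positive [t]: halving
     [sigma i] improves it. *)
  have half_gt0 : 0 < sigma i / 2 by lra.
  by have := coord _ half_gt0; rewrite b0 expr0n /= !mul0r; lra.
have nb_gt0 : 0 < `|b| by rewrite normr_gt0.
(* Comparing with the minimizer and multiplying by [sigma i] bounds a square above by 0. *)
have := coord _ nb_gt0; rewrite -(real_normK (num_real b)).
have -> : `|b| ^+ 2 / `|b| = `|b| by rewrite expr2 mulfK // gt_eqF.
rewrite -(ler_pM2r s_gt0) !mulrDl divfK ?gt_eqF // => le_sq.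
have : (sigma i - `|b|) ^+ 2 <= 0 by rewrite sqrrB !expr2 mulr2n in le_sq *; lra.
by rewrite le_eqVlt ltNge sqr_ge0 orbF sqrf_eq0 subr_eq0 => /eqP ->.
Qed.

Lemma dual_point01 i : rho i = 0 \/ rho i = 1.
Proof.
have s_neq0 : sigma i != 0 by rewrite gt_eqF.
have /eqP := dual_max_sqr i; rewrite eqf_sqr => /orP[] /eqP sE.
- right; have -> : rho i = (sigma i + (c i - s * a i)) / (2 * sigma i).
    by congr (_ / _); ring.
  by rewrite -sE; field.
- left; have -> : rho i = (sigma i + (c i - s * a i)) / (2 * sigma i).
    by congr (_ / _); ring.
  by rewrite {1}sE addNr mul0r.
Qed.

(** At the dual point the square in the weak duality gap vanishes term by term, and slackness
    removes the volume term. *)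
Lemma knapsack_strong_duality : - \sum_i c i * rho i = knapsack_dual sigma s.
Proof.
have term i : c i * rho i =
    1 / 4 * ((sigma i - s * a i + c i) ^+ 2 / sigma i) + s * (rho i * a i).
  have rho_sq : rho i ^+ 2 = rho i.
    by case: (dual_point01 i) => ->; rewrite ?expr0n ?expr1n.
  have s_neq0 : sigma i != 0 by rewrite gt_eqF.
  have tE : sigma i - s * a i + c i = 2 * sigma i * rho i.
    by rewrite /dual_point; field.
  have cE : c i = 2 * sigma i * rho i - sigma i + s * a i by rewrite -tE; ring.
  rewrite tE {1}cE.
  have -> : (2 * sigma i * rho i) ^+ 2 / sigma i = 4 * sigma i * rho i ^+ 2 by field.
  have -> : (2 * sigma i * rho i - sigma i + s * a i) * rho i =
      2 * sigma i * rho i ^+ 2 - sigma i * rho i + s * (rho i * a i) by ring.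
  by rewrite rho_sq; field.
rewrite (eq_bigr _ (fun i _ => term i)) big_split /= -!mulr_sumr /knapsack_dual.
by have := dual_point_slackness; lra.
Qed.

End Maximizer.
End KnapsackDual.

(** * From the matrix formulation to coordinate sums *)

Section Coordinates.
Variables (R : realType) (d m n : nat) (M : fe_model R d m n).
Variables (Vc : R) (u : 'cV[R]_m).

Local Notation c := (fun e => energy_vec M u e 0).
Local Notation a := (fun e => vol_vec M e 0).

Lemma PuE (rho : 'cV[R]_n) : Pu M u rho = - \sum_e c e * rho e 0.
Proof.
by rewrite /Pu mxE; congr (- _); apply: eq_bigr => e _; rewrite mxE.
Qed.

Lemma ZaE (rho : 'cV[R]_n) : Za M Vc rho <->
  (forall e, rho e 0 = 0 \/ rho e 0 = 1) /\ \sum_e rho e 0 * a e <= Vc.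
Proof.
rewrite /Za /= mxE.
by rewrite (eq_bigr (fun e => rho e 0 * a e)) // => e _; rewrite mxE.
Qed.

Lemma tauE zeta e : tau M u zeta e 0 = zeta.1 e 0 - zeta.2 * a e + c e.
Proof. by rewrite !mxE. Qed.

Lemma invmx_GmxE (zeta : 'cV[R]_n * R) : (forall e, 0 < zeta.1 e 0) ->
  invmx (Gmx zeta) = diag_mx (\row_e (zeta.1 e 0)^-1).
Proof.
move=> zeta_gt0; rewrite /Gmx invmx_diag_mx => [|e]; last by rewrite mxE gt_eqF.
by congr diag_mx; apply/rowP => e; rewrite !mxE.
Qed.

Lemma PduE (zeta : 'cV[R]_n * R) : (forall e, 0 < zeta.1 e 0) ->
  Pdu M Vc u zeta = knapsack_dual c a Vc (fun e => zeta.1 e 0) zeta.2.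
Proof.
move=> zeta_gt0; rewrite /Pdu /knapsack_dual invmx_GmxE //.
congr (_ * _ - _); rewrite mxE; apply: eq_bigr => e _.
rewrite mul_mx_diag mxE [_^T _ _]mxE [(\row__ _) _ _]mxE tauE.
by rewrite mulrAC -expr2.
Qed.

Lemma dual_pointE (zeta : 'cV[R]_n * R) e : (forall e, 0 < zeta.1 e 0) ->
  ((1 / 2) *: (invmx (Gmx zeta) *m tau M u zeta)) e 0 =
  dual_point c a (fun e => zeta.1 e 0) zeta.2 e.
Proof.
move=> zeta_gt0; rewrite invmx_GmxE // mxE mul_diag_mx mxE [(\row__ _) _ _]mxE tauE.
by rewrite /dual_point; field; rewrite gt_eqF.
Qed.

End Coordinates.

Theorem theorem2 (R : realType) (d m n : nat) (M : fe_model R d m n)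
    (Vc : R) (hVc : 0 < Vc) (u : 'cV[R]_m) (hu : fe_adm M u)
    (zeta : 'cV[R]_n * R)
    (hzeta : global_maximizer (@Sa_plus R n) (Pdu M Vc u) zeta) :
  let rho := (1 / 2) *: (invmx (Gmx zeta) *m tau M u zeta) in
  global_minimizer (Za M Vc) (Pu M u) rho /\
  exists vmin vmax : R,
    [/\ is_min (Za M Vc) (Pu M u) vmin,
        is_max (@Sa_plus R n) (Pdu M Vc u) vmax
      & [/\ Pu M u rho = vmin, vmin = vmax & vmax = Pdu M Vc u zeta]].
Proof.
move=> rho; case: hzeta => -[zeta_gt0 zeta2_ge0] zeta_max.
pose c e := energy_vec M u e 0; pose a e := vol_vec M e 0.
pose sigma e := zeta.1 e 0.
have rhoE e : rho e 0 = dual_point c a sigma zeta.2 e by exact: dual_pointE.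
(* Maximality over column vectors is restated over functions on the index type, as the scalar
   results require. *)
have dual_max sigma' s' : (forall e, 0 < sigma' e) -> 0 <= s' ->
    knapsack_dual c a Vc sigma' s' <= knapsack_dual c a Vc sigma zeta.2.
  move=> sigma'_gt0 s'_ge0.
  have sigma'E : (fun e => (\col_i sigma' i : 'cV[R]_n) e 0) = sigma'.
    by apply/funext => e; rewrite mxE.
  have z_gt0 e : 0 < (\col_i sigma' i : 'cV[R]_n) e 0 by rewrite mxE.
  have := zeta_max (\col_i sigma' i, s') (conj z_gt0 s'_ge0).
  by rewrite !PduE //= sigma'E.
have rhoZ : Za M Vc rho.
  apply/ZaE; split=> [e|].
    by rewrite rhoE; exact: dual_point01 dual_max e.
  under eq_bigr do rewrite rhoE.
  exact: dual_point_feasible dual_max.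
have rhoP : Pu M u rho = Pdu M Vc u zeta.
  rewrite PuE PduE //; under eq_bigr do rewrite rhoE.
  exact: knapsack_strong_duality dual_max.
have rho_min y : Za M Vc y -> Pu M u rho <= Pu M u y.
  by move=> /ZaE[y01 yV]; rewrite rhoP PduE // PuE; exact: knapsack_weak_duality.
split; first by split.
exists (Pu M u rho), (Pdu M Vc u zeta); split=> //.
- by split=> [|_ [y yZ <-]]; [exists rho | exact: rho_min].
- by split=> [|_ [y yS <-]]; [exists zeta | exact: zeta_max].
Qed.
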